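(* Let $u, v \in A^*$. Then $u \equiv_{\mathrm{B}} v$ if and only if $\mathbb{P}(u) = \mathbb{P}(v)$.
   Context: $A = \{a_1 < a_2 < \cdots\}$ is a totally ordered infinite alphabet and $A^*$ is the free monoid on $A$. An equivalence relation $\equiv$ on $A^*$ is a congruence if $u \equiv u'$ and $v \equiv v'$ imply $uv \equiv u'v'$. The Baxter congruence $\equiv_{\mathrm{B}}$ is the smallest congruence on $A^*$ (i.e. the reflexive, symmetric and transitive closure of rewriting factors of words) generated by the following relations, for $u, v \in A^*$ and letters $a,b,c,d \in A$: $c\,u\,a\,d\,v\,b \leftrightarrow c\,u\,d\,a\,v\,b$ where $a \leq b < c \leq d$; and $b\,u\,d\,a\,v\,c \leftrightarrow b\,u\,a\,d\,v\,c$ where $a < b \leq c < d$. Binary trees are planar, each (internal) node having a left and a right subtree, possibly empty; $\perp$ is the empty tree. A binary tree with nodes labeled by $A$ is a left (resp. right) binary search tree if for every node labeled $b$, every label $a$ in its left subtree and every label $c$ in its right subtree satisfy $a < b \leq c$ (resp. $a \leq b < c$). Leaf insertion of a letter $a$ into a left (resp. right) binary search tree $T$: if $T = \perp$, the result is the one-node tree labeled $a$; otherwise, if the label $b$ of the root satisfies $a < b$ (resp. $a \leq b$), leaf-insert $a$ into the left subtree, else leaf-insert $a$ into the right subtree. For a right binary search tree $T$ and a letter $b$, $T_{\leq b}$ (resp. $T_{>b}$) is the right binary search tree made exactly of the nodes of $T$ with label $\leq b$ (resp. $> b$) and such that, for nodes $x,y$, if $x$ is an ancestor of $y$ in the restricted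 tree then $x$ is an ancestor of $y$ in $T$. Root insertion of $a$ into a right binary search tree $T$ yields the tree whose root is a new node labeled $a$, with left subtree $T_{\leq a}$ and right subtree $T_{>a}$. The $\mathbb{P}$-symbol $\mathbb{P}(u) = (T_L, T_R)$ of a word $u \in A^*$ is the pair of labeled trees obtained starting from $(\perp,\perp)$ by inserting the letters of $u$ one by one from left to right, where inserting a letter $a$ into $(T_L,T_R)$ means making a leaf insertion of $a$ into the left binary search tree $T_L$ and a root insertion of $a$ into the right binary search tree $T_R$. *)

(* Defs.v *)
From Stdlib Require Import ClassicalEpsilon.
From mathcomp Require Import all_boot all_order.

Set Implicit Arguments.
Unset Strict Implicit.
Unset Printing Implicit Defensive.

Import Order.TTheory.
Local Open Scope order_scope.

Inductive tree (A : Type) : Type :=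
| Leaf
| Node of tree A & A & tree A.

Arguments Leaf {A}.
Arguments Node {A} _ _ _.

Section Trees.
Variable A : Type.
Implicit Types t : tree A.

Fixpoint labels t : seq A :=
  if t is Node l x r then labels l ++ x :: labels r else [::].

(* A node is identified with the path leading to it from the root ([false]
   goes left, [true] goes right), so that distinct nodes carrying the same
   label are told apart; [p] is an ancestor of [q] when [prefix p q]. *)
Fixpoint label_at t (p : seq bool) : option A :=
  if t is Node l x r then
    if p is e :: p' then label_at (if e then r else l) p' else Some x
  else None.

Definition is_node t p : bool := isSome (label_at t p).

End Trees.

Section Words.
Context {d : Order.disp_t} {A : orderType d}.
Implicit Types (t : tree A) (a b c x : A) (u v w : seq A).

Inductive baxter_gen : seq A -> seq A -> Prop :=
| baxter_gen1 u v a b c d' : a <= b -> b < c -> c <= d' ->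
    baxter_gen (c :: u ++ a :: d' :: v ++ [:: b])
               (c :: u ++ d' :: a :: v ++ [:: b])
| baxter_gen2 u v a b c d' : a < b -> b <= c -> c < d' ->
    baxter_gen (b :: u ++ d' :: a :: v ++ [:: c])
               (b :: u ++ a :: d' :: v ++ [:: c]).

Inductive baxter_cong : seq A -> seq A -> Prop :=
| baxter_cong_gen u v : baxter_gen u v -> baxter_cong u v
| baxter_cong_refl u : baxter_cong u u
| baxter_cong_sym u v : baxter_cong u v -> baxter_cong v u
| baxter_cong_trans u v w :
    baxter_cong u v -> baxter_cong v w -> baxter_cong u w
| baxter_cong_cat u u' v v' :
    baxter_cong u u' -> baxter_cong v v' -> baxter_cong (u ++ v) (u' ++ v').

Fixpoint right_bst t : bool :=
  if t is Node l b r then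
    [&& all (fun a => a <= b) (labels l), all (fun c => b < c) (labels r),
        right_bst l & right_bst r]
  else true.

Fixpoint left_leaf_insert a t : tree A :=
  if t is Node l b r then
    if a < b then Node (left_leaf_insert a l) b r
    else Node l b (left_leaf_insert a r)
  else Node Leaf a Leaf.

(* The map [f] identifies the nodes of [t'] with the nodes of [t] whose label
   satisfies [P]. *)
Definition is_restriction (P : pred A) t t' : Prop :=
  right_bst t' /\
  exists f : seq bool -> seq bool,
    [/\ forall p, is_node t' p -> label_at t (f p) = label_at t' p,
        {in is_node t' &, injective f},
        forall q x, label_at t q = Some x ->
          P x <-> exists2 p, is_node t' p & f p = q
      & forall p p', is_node t' p -> is_node t' p' ->
          prefix p p' -> prefix (f p) (f p')].

(* The tree singled out by [is_restriction]; it exists and is unique when [t]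
   is a right binary search tree and [P] is [<= b] or [> b]. *)
Definition restriction (P : pred A) t : tree A :=
  epsilon (inhabits Leaf) (is_restriction P t).

Definition root_insert a t : tree A :=
  Node (restriction (fun x => x <= a) t) a (restriction (fun x => a < x) t).

Definition Psymbol_insert (T : tree A * tree A) a : tree A * tree A :=
  (left_leaf_insert a T.1, root_insert a T.2).

Definition Psymbol u : tree A * tree A := foldl Psymbol_insert (Leaf, Leaf) u.

End Words.

(* Main.v *)
Require Import Defs.
From Stdlib Require Import ClassicalEpsilon.
From mathcomp Require Import all_boot all_order.

Set Implicit Arguments.
Unset Strict Implicit.
Unset Printing Implicit Defensive.

Import Order.TTheory.

(** Both components of the P-symbol are trees built by leaf insertions: the
    left one by inserting the letters of the word from left to right, comparing
    with [<], and the right one by inserting them from right to left, comparing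
    with [<=], because a root insertion puts the last letter at the root and
    splits the earlier ones around it ([PsymbolE]).  A tree of leaf insertions
    has a simple recursive description: the first inserted letter [e] is the
    root, and the two subtrees are the trees of the subwords of the remaining
    letters that go to the left and to the right of [e] ([search_tree_cons]).

    Say that [c] separates [x] and [y] when the two letters go to different
    sides of [c].  For [x < y] this means [x < c <= y] in the left tree and
    [x <= c < y] in the right tree.  Two distinct adjacent letters can be
    exchanged by one generator of the Baxter congruence exactly when they are
    separated, for the left order, by a letter before them and, for the right
    order, by a letter after them; which of the two generators applies depends
    on the relative order of the two separators ([baxter_swap]).

    Insertions of two letters commute once a separator of them is present,
    since they then end up in disjoint subtrees ([swap_separated]); hence
    congruent words have the same P-symbol.

    Conversely, take two words with the same P-symbol and a common prefix [p],
    the second one continuing with [x].  In the first one, the first [x] after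
    [p] is moved back to the end of [p], one exchange at a time.  Each such
    exchange concerns adjacent letters [y x] that occur in the opposite order
    in the second word.  If nothing inserted before them separated them, the
    first of them would be an ancestor of the second in the common tree, and so
    would be inserted first in both words.  So separators exist in both trees
    ([separator_of_inversion]), the exchange is a Baxter one, and it preserves
    the P-symbol.  Induction on the length of the rest of the second word
    concludes. *)

(** * Search trees built by leaf insertions *)

Section SearchTree.
Variables (A : eqType) (lt : rel A).
Implicit Types (t : tree A) (x y c e : A) (p q r s u v w : seq A).

(** The relation [lt] decides which letters go to the left of a node, so that
    the left and right search trees are the instances [<] and [<=]. *)
Fixpoint leaf_insert x t : tree A :=
  if t is Node l e r then
    if lt x e then Node (leaf_insert x l) e r else Node l e (leaf_insert x r)
  else Node Leaf x Leaf.

Definition search_tree w : tree A :=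
  foldl (fun t x => leaf_insert x t) Leaf w.

Lemma search_tree_cons e w :
  search_tree (e :: w) =
  Node (search_tree [seq x <- w | lt x e]) e
       (search_tree [seq x <- w | ~~ lt x e]).
Proof.
rewrite /search_tree /=; set ins := fun t x => leaf_insert x t.
suff split_foldl (l r : tree A) : foldl ins (Node l e r) w =
    Node (foldl ins l [seq x <- w | lt x e]) e
         (foldl ins r [seq x <- w | ~~ lt x e]) by [].
elim: w l r => //= x w IHw l r.
by rewrite {1}/ins /=; case: (lt x e) => /=; rewrite IHw.
Qed.

(** The induction that follows the recursive structure of the tree of [w]. *)
Lemma search_tree_ind (P : seq A -> Prop) :
    P [::] ->
    (forall e w, P [seq x <- w | lt x e] -> P [seq x <- w | ~~ lt x e] ->
       P (e :: w)) ->
  forall w, P w.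
Proof.
move=> P0 Pcons w; have [n] := ubnP (size w).
elim: n w => // n IHn [|e w] //= ltwn.
have small (R : pred A) : size (filter R w) < n.
  by rewrite size_filter (leq_ltn_trans (count_size _ _)).
by apply: Pcons; apply: IHn.
Qed.

Lemma perm_labels_search_tree w : perm_eq (labels (search_tree w)) w.
Proof.
elim/search_tree_ind: w => // e w IHl IHr.
rewrite search_tree_cons /= perm_catC cat_cons perm_cons perm_catC.
by apply: perm_trans (perm_cat IHl IHr) _; rewrite perm_filterC.
Qed.

Lemma search_tree_perm v w : search_tree v = search_tree w -> perm_eq v w.
Proof.
move=> eqvw; apply: perm_trans (perm_labels_search_tree w).
by rewrite -eqvw perm_sym perm_labels_search_tree.
Qed.

Definition separates c x y : bool := lt x c != lt y c.

(** Going down the tree of [p], the letters [x] and [y] stay together until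
    they meet a node that separates them; below it they are inserted in
    disjoint subtrees.  The two order hypotheses ensure that, as long as they
    stay together, the separator [c] lies on their side, so that they do meet
    a separating node. *)
Lemma swap_separated c x y p q :
    transitive lt ->
    (forall x y z, lt x z -> lt x y || lt y z) ->
    c \in p -> separates c x y ->
  search_tree (p ++ x :: y :: q) = search_tree (p ++ y :: x :: q).
Proof.
move=> lt_trans lt_cotrans; elim/search_tree_ind: p q => // e p IHl IHr q.
rewrite inE => c_ep sep; rewrite !cat_cons !search_tree_cons !filter_cat /=.
have [sep_e | /negbNE/eqP same] := boolP (separates e x y).
  by move: sep_e; rewrite /separates; case: (lt x e); case: (lt y e).
have cp : c \in p.
  by case/predU1P: c_ep => // eq_ce; rewrite /separates eq_ce same eqxx in sep.
have c_side : lt c e = lt x e.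
  move: sep; rewrite /separates; apply: contraNeq => c_opp.
  have same_c z : lt z e = lt x e -> lt z c = lt x e.
    move: c_opp; case: (lt x e); case ce: (lt c e) => // _ ze.
      by have := lt_cotrans z c e ze; rewrite ce orbF.
    by apply/negP => /lt_trans/(_ ce); rewrite ze.
  by rewrite !same_c.
rewrite -!same; case xe: (lt x e) => /=.
  by rewrite IHl // mem_filter c_side xe.
by rewrite IHr // mem_filter c_side xe.
Qed.

(** Occurrences of a letter are matched by their rank: the count hypotheses
    say that, in the second word, the prefix [s] contains the occurrence of [y]
    shown in the first word but not the one of [x].  If [x] and [y] are not
    separated by the common root, both words can be restricted to the side of
    the root that contains them, and all ranks are preserved.  When [q] is
    exhausted, [x] is the root, hence the first letter of [s], which
    contradicts its rank. *)
Lemma separator_of_inversion x y q r s v :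
    search_tree (q ++ x :: y :: r) = search_tree (s ++ v) ->
    count_mem y q < count_mem y s -> count_mem x s <= count_mem x q ->
  exists2 c, c \in q & separates c x y.
Proof.
elim/search_tree_ind: q s r v => [|e q IHl IHr] [|f s] r v //=;
  rewrite !search_tree_cons => -[].
  by move=> _ <- _ _; rewrite eqxx.
move=> eql ef; rewrite -{}ef in eql * => eqr.
rewrite ltn_add2l leq_add2l => lty lex.
have [sep | /negbNE/eqP same] := boolP (separates e x y).
  by exists e; rewrite ?mem_head.
have count_side (P : pred A) z w :
    P z -> count_mem z (filter P w) = count_mem z w.
  move=> Pz; rewrite count_filter; apply: eq_count => z' /=.
  by case: eqP => // ->.
move: eql eqr; rewrite !filter_cat /= -same; case xe: (lt x e) => /= eql eqr.
  have [||c] := IHl _ _ _ eql; rewrite ?count_side // -?same //.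
  by rewrite mem_filter => /andP[_ cq]; exists c; rewrite // inE cq orbT.
have [||c] := IHr _ _ _ eqr; rewrite ?count_side -?same ?xe //.
by rewrite mem_filter => /andP[_ cq]; exists c; rewrite // inE cq orbT.
Qed.

End SearchTree.

(** * Restrictions of right binary search trees *)

Section Restriction.
Context {d : Order.disp_t} {A : orderType d}.
Implicit Types (t l r : tree A) (x : A) (w : seq A) (P : pred A).
Implicit Types (p q : seq bool) (f g : seq bool -> seq bool).
Local Open Scope order_scope.

Lemma label_at_labels t p x : label_at t p = Some x -> x \in labels t.
Proof.
elim: t p => //= l IHl e r IHr [[<-]|[] p /=].
- by rewrite mem_cat mem_head orbT.
- by move/IHr => xr; rewrite mem_cat inE xr !orbT.
by move/IHl => xl; rewrite mem_cat xl.
Qed.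

(** The correspondence of [is_restriction] for an arbitrary set [Q] of retained
    nodes: this generality is what lets uniqueness go by induction, the nodes
    of a subtree of [t'] being cut out of [t] by a condition on both positions
    and labels. *)
Definition places t t' (Q : seq bool -> Prop) f : Prop :=
  [/\ forall p, is_node t' p -> label_at t (f p) = label_at t' p,
      {in is_node t' &, injective f},
      forall q, Q q <-> exists2 p, is_node t' p & f p = q
    & forall p p', is_node t' p -> is_node t' p' ->
        prefix p p' -> prefix (f p) (f p')].

Lemma prefix_anti p q : prefix p q -> prefix q p -> p = q.
Proof.
by elim: p q => [|x p IHp] [|y q] //= /andP[/eqP<- /IHp pq] /andP[_ /pq ->].
Qed.

Lemma places_root t l x r Q f :
  places t (Node l x r) Q f -> Q (f [::]) /\ forall q, Q q -> prefix (f [::]) q.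
Proof.
move=> [_ _ imf monof]; split; first by apply/imf; exists [::].
by move=> q /imf[p np <-]; apply: monof => //; apply: prefix0s.
Qed.

Lemma places_left t l x r Q f :
    right_bst (Node l x r) -> places t (Node l x r) Q f ->
  places t l
    (fun q => [/\ Q q, q <> f [::] & exists2 y, label_at t q = Some y & y <= x])
    (fun p => f (false :: p)).
Proof.
move=> /= /and4P[/allP lel /allP ltr _ _] [labf injf imf monof]; split.
- by move=> p np; apply: (labf (false :: p)).
- by move=> p q np nq /(injf (false :: p) (false :: q) np nq)[].
- move=> q; split=> [[/imf[[|[] p] np <-] // _ [y]]|[p np <-]].
  + rewrite labf //= => /label_at_labels yr.
    by rewrite leNgt (ltr _ yr).
  + by exists p.
  split; first by apply/imf; exists (false :: p).
    by move/(injf (false :: p) [::] np isT).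
  have: isSome (label_at l p) by [].
  case laby: (label_at l p) => [y|] // _; exists y; first by rewrite labf.
  exact: lel (label_at_labels laby).
by move=> p p' np np' pp'; apply: monof => //=; rewrite eqxx.
Qed.

Lemma places_right t l x r Q f :
    right_bst (Node l x r) -> places t (Node l x r) Q f ->
  places t r
    (fun q => [/\ Q q, q <> f [::] & exists2 y, label_at t q = Some y & x < y])
    (fun p => f (true :: p)).
Proof.
move=> /= /and4P[/allP lel /allP ltr _ _] [labf injf imf monof]; split.
- by move=> p np; apply: (labf (true :: p)).
- by move=> p q np nq /(injf (true :: p) (true :: q) np nq)[].
- move=> q; split=> [[/imf[[|[] p] np <-] // _ [y]]|[p np <-]].
  + by exists p.
  + rewrite labf //= => /label_at_labels yl.
    by rewrite ltNge (lel _ yl).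
  split; first by apply/imf; exists (true :: p).
    by move/(injf (true :: p) [::] np isT).
  have: isSome (label_at r p) by [].
  case laby: (label_at r p) => [y|] // _; exists y; first by rewrite labf.
  exact: ltr (label_at_labels laby).
by move=> p p' np np' pp'; apply: monof => //=; rewrite eqxx.
Qed.

(** The root of the restricted tree must sit at the retained node of [t] that is
    an ancestor of all the others, and the search tree property then decides by
    labels which retained nodes belong to each of its subtrees. *)
Lemma places_uniq t t1 t2 Q1 Q2 f1 f2 :
    (forall q, Q1 q <-> Q2 q) -> right_bst t1 -> right_bst t2 ->
  places t t1 Q1 f1 -> places t t2 Q2 f2 -> t1 = t2.
Proof.
elim: t1 t2 Q1 Q2 f1 f2 => [|l1 IHl x1 r1 IHr] [|l2 x2 r2] Q1 Q2 f1 f2 eqQ //.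
- by move=> _ _ [_ _ im1 _] /places_root[/eqQ/im1[]].
- by move=> _ _ /places_root[/eqQ + _] [_ _ im2 _] => /im2[].
move=> bst1 bst2 pl1 pl2.
have [Q1f1 min1] := places_root pl1; have [Q2f2 min2] := places_root pl2.
have eqf : f1 [::] = f2 [::].
  by apply: prefix_anti; [apply/min1/eqQ | apply/min2/eqQ].
have eqx : x1 = x2.
  have [lab1 _ _ _] := pl1; have [lab2 _ _ _] := pl2.
  by have := lab1 [::] isT; rewrite eqf lab2 // => -[].
have bst_sub (l r : tree A) x :
  right_bst (Node l x r) -> right_bst l /\ right_bst r by case/and4P.
have [bl1 br1] := bst_sub _ _ _ bst1; have [bl2 br2] := bst_sub _ _ _ bst2.
rewrite eqx; congr Node.
  have [pll1 pll2] := (places_left bst1 pl1, places_left bst2 pl2).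
  apply: (IHl _ _ _ _ _ _ bl1 bl2 pll1 pll2).
  by move=> q; rewrite eqf eqx; split=> -[/eqQ].
have [plr1 plr2] := (places_right bst1 pl1, places_right bst2 pl2).
apply: (IHr _ _ _ _ _ _ br1 br2 plr1 plr2).
by move=> q; rewrite eqf eqx; split=> -[/eqQ].
Qed.

Lemma is_restriction_places P t t' :
    is_restriction P t t' ->
  exists f, places t t' (fun q => exists2 x, label_at t q = Some x & P x) f.
Proof.
move=> [_ [f [labf injf imf monof]]]; exists f; split=> // q; split.
  by move=> [x labx Px]; apply/(imf q x).
move=> [p np fp]; have: isSome (label_at t' p) by [].
case laby: (label_at t' p) => [y|] // _; rewrite -labf // fp in laby.
by exists y => //; apply/(imf q y) => //; exists p.
Qed.

(** By uniqueness, the tree selected by [epsilon] is any tree satisfying the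
    specification. *)
Lemma restrictionE P t t' : is_restriction P t t' -> restriction P t = t'.
Proof.
move=> restr; have restr' : is_restriction P t (restriction P t).
  by apply: epsilon_spec; exists t'.
have [f pl] := is_restriction_places restr.
have [g pl'] := is_restriction_places restr'.
by apply: (places_uniq _ _ _ pl' pl); [|case: restr'|case: restr].
Qed.

Lemma right_bst_search_tree w : right_bst (search_tree <=%O w).
Proof.
elim/(search_tree_ind (lt := <=%O : rel A)): w => // e w IHl IHr.
rewrite search_tree_cons /= IHl IHr !(perm_all _ (perm_labels_search_tree _ _)).
rewrite filter_all /= andbT.
have ltNle x : (e < x) = ~~ (x <= e) by rewrite ltNge.
by rewrite (eq_all ltNle) filter_all.
Qed.

(** If the root [e] is retained, the correspondence is built from those of the
    two subtrees.  If it is not, convexity forces all retained letters onto one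
    side of [e], and the correspondence of that subtree is used. *)
Lemma is_restriction_search_tree P w :
    (forall e x y, P x -> P y -> ~~ P e -> (x <= e) = (y <= e)) ->
  is_restriction P (search_tree <=%O w) (search_tree <=%O (filter P w)).
Proof.
move=> convexP; split; first exact: right_bst_search_tree.
elim/(search_tree_ind (lt := <=%O : rel A)): w => [|e w].
  by exists id; split=> // q x; case: q.
set wl := filter _ w; set wr := filter _ w => - [f [labf injf imf monof]].
move=> [g [labg injg img monog]].
rewrite /= search_tree_cons -/wl -/wr; case: ifPn => Pe.
  have filterC (R : pred A) : filter R (filter P w) = filter P (filter R w).
    by rewrite -!filter_predI; apply: eq_filter => x; apply: andbC.
  rewrite search_tree_cons !filterC -/wl -/wr.
  exists (fun p =>
    if p is b :: p' then b :: (if b then g p' else f p') else [::]).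
  split.
  - by move=> [|[] p] //=; [apply: labg | apply: labf].
  - move=> [|[] p] [|[] q] //= np nq [].
      by move/injg => ->.
    by move/injf => ->.
  - move=> [|[] q] x /= labx.
    + by case: labx => <-; rewrite Pe; split=> // _; exists [::].
    + rewrite (img _ _ labx); split=> [[p np <-]|[[|[] p] // np [eqp]]].
        by exists (true :: p).
      by exists p.
    rewrite (imf _ _ labx); split=> [[p np <-]|[[|[] p] // np [eqp]]].
      by exists (false :: p).
    by exists p.
  move=> [|[] p] [|[] q] //= np nq /= pq; first exact: monog.
  exact: monof.
have [b side] : exists b, {in w, forall x, P x -> (x <= e) = b}.
  have [/hasP[z _ Pz] | /hasPn noP] := boolP (has P w).
    by exists (z <= e) => x _ Px; apply: (convexP e).
  (* No letter is retained, so the choice of side is arbitrary. *)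
  by exists true => x /noP/negbTE->.
have lab_l q x :
  label_at (search_tree <=%O wl) q = Some x -> x <= e /\ x \in w.
  move/label_at_labels; rewrite (perm_mem (perm_labels_search_tree _ _)).
  by rewrite mem_filter => /andP[].
have lab_r q x :
  label_at (search_tree <=%O wr) q = Some x -> ~~ (x <= e) /\ x \in w.
  move/label_at_labels; rewrite (perm_mem (perm_labels_search_tree _ _)).
  by rewrite mem_filter => /andP[].
case: b side => side.
  have eqw : filter P wl = filter P w.
    rewrite -filter_predI; apply: eq_in_filter => x xw /=.
    by case Px: (P x); rewrite //= side.
  rewrite -eqw; exists (fun p => false :: f p); split=> //=.
  - by move=> p q np nq [] /injf ->.
  move=> [|[] q] x /= labx.
  + by case: labx => <-; rewrite (negbTE Pe); split=> // -[].
  + split=> [Px|[] //]; have [+ xw] := lab_r _ _ labx.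
    by rewrite side.
  by rewrite (imf _ _ labx); split=> [[p np <-]|[p np [eqp]]]; exists p.
have eqw : filter P wr = filter P w.
  rewrite -filter_predI; apply: eq_in_filter => x xw /=.
  by case Px: (P x); rewrite //= side.
rewrite -eqw; exists (fun p => true :: g p); split=> //=.
- by move=> p q np nq [] /injg ->.
move=> [|[] q] x /= labx.
- by case: labx => <-; rewrite (negbTE Pe); split=> // -[].
- by rewrite (img _ _ labx); split=> [[p np <-]|[p np [eqp]]]; exists p.
split=> [Px|[] //]; have [+ xw] := lab_l _ _ labx.
by rewrite side.
Qed.

Lemma restriction_search_tree P w :
    (forall e x y, P x -> P y -> ~~ P e -> (x <= e) = (y <= e)) ->
  restriction P (search_tree <=%O w) = search_tree <=%O (filter P w).
Proof. by move=> convexP; apply/restrictionE/is_restriction_search_tree. Qed.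

Lemma root_insert_search_tree x w :
  root_insert x (search_tree <=%O w) = search_tree <=%O (x :: w).
Proof.
rewrite search_tree_cons /root_insert !restriction_search_tree.
- by congr Node; congr search_tree; apply: eq_filter => y; rewrite ltNge.
- move=> e y z xy xz; rewrite -leNgt => ex.
  by rewrite !leNgt (le_lt_trans ex xy) (le_lt_trans ex xz).
move=> e y z yx zx; rewrite -ltNge => xe.
by rewrite (le_trans yx (ltW xe)) (le_trans zx (ltW xe)).
Qed.

End Restriction.

(** * The Baxter congruence *)

Section Baxter.
Context {d : Order.disp_t} {A : orderType d}.
Implicit Types (t : tree A) (x y z a b c : A) (p q s u v w : seq A).
Local Open Scope order_scope.

Lemma left_leaf_insertE x t : left_leaf_insert x t = leaf_insert <%O x t.
Proof. by elim: t => //= l -> e r ->. Qed.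

Lemma PsymbolE u :
  Psymbol u = (search_tree <%O u, search_tree <=%O (rev u)).
Proof.
elim/last_ind: u => // u x IHu.
rewrite /Psymbol foldl_rcons -/(Psymbol u) IHu /Psymbol_insert /=.
rewrite root_insert_search_tree rev_rcons left_leaf_insertE.
by rewrite /search_tree foldl_rcons.
Qed.

Lemma Psymbol_swap x y b c p q :
    c \in p -> separates <%O c x y -> b \in q -> separates <=%O b x y ->
  Psymbol (p ++ x :: y :: q) = Psymbol (p ++ y :: x :: q).
Proof.
move=> cp sep_c bq sep_b; rewrite !PsymbolE; congr pair.
  apply: swap_separated cp sep_c; first exact: lt_trans.
  by move=> x1 x2 x3 lt13; case: (ltP x1 x2) => //= /le_lt_trans; apply.
have rev_mv x1 x2 : rev (p ++ x1 :: x2 :: q) = rev q ++ x2 :: x1 :: rev p.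
  by rewrite rev_cat !rev_cons !cat_rcons.
rewrite !rev_mv; apply: (swap_separated (c := b)); first exact: le_trans.
- by move=> x1 x2 x3 le13; case: (leP x1 x2) => //= /ltW/le_trans; apply.
- by rewrite mem_rev.
by rewrite /separates eq_sym.
Qed.

Lemma separates_ltP c x y : x < y -> separates <%O c x y = (x < c) && (c <= y).
Proof.
rewrite /separates => xy; case: (ltP y c) => [yc | cy]; last by case: (x < c).
by rewrite (lt_trans xy yc).
Qed.

Lemma separates_leP c x y : x < y -> separates <=%O c x y = (x <= c) && (c < y).
Proof.
rewrite /separates => xy; case: (leP y c) => [yc | cy]; last by case: (x <= c).
by rewrite (le_trans (ltW xy) yc).
Qed.

Lemma separatesC (lt : rel A) c x y : separates lt c x y = separates lt c y x.
Proof. by rewrite /separates eq_sym. Qed.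

Lemma baxter_gen_Psymbol u v p q :
  baxter_gen u v -> Psymbol (p ++ u ++ q) = Psymbol (p ++ v ++ q).
Proof.
case=> {u v} [u v a b c e ab bc ce | u v a b c e ab bc ce].
  have mv x y : p ++ (c :: u ++ x :: y :: v ++ [:: b]) ++ q =
      (p ++ c :: u) ++ x :: y :: v ++ b :: q by rewrite /= -!catA /= -!catA.
  have ae := lt_le_trans (le_lt_trans ab bc) ce.
  rewrite !mv; apply: (@Psymbol_swap _ _ b c).
  - by rewrite mem_cat mem_head orbT.
  - by rewrite separates_ltP // (le_lt_trans ab bc) ce.
  - by rewrite mem_cat mem_head orbT.
  by rewrite separates_leP // ab (lt_le_trans bc ce).
have mv x y : p ++ (b :: u ++ x :: y :: v ++ [:: c]) ++ q =
    (p ++ b :: u) ++ x :: y :: v ++ c :: q by rewrite /= -!catA /= -!catA.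
have ae := lt_trans (lt_le_trans ab bc) ce.
rewrite !mv; apply/esym/(@Psymbol_swap _ _ c b).
- by rewrite mem_cat mem_head orbT.
- by rewrite separates_ltP // ab (ltW (le_lt_trans bc ce)).
- by rewrite mem_cat mem_head orbT.
by rewrite separates_leP // (ltW (lt_le_trans ab bc)) ce.
Qed.

(** Quantifying over the contexts makes the case of concatenations immediate:
    one factor is replaced while the other is part of the context. *)
Lemma baxter_cong_Psymbol u v :
  baxter_cong u v -> forall p q, Psymbol (p ++ u ++ q) = Psymbol (p ++ v ++ q).
Proof.
elim=> {u v} [u v uv p q||u v _ IH p q|u v w _ IHuv _ IHvw p q|].
- exact: baxter_gen_Psymbol.
- by [].
- by rewrite IH.
- by rewrite IHuv.
move=> u u' v v' _ IHu _ IHv p q.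
by rewrite -!catA IHu !(catA p) IHv.
Qed.

Lemma baxter_cong_ctx u v p q :
  baxter_cong u v -> baxter_cong (p ++ u ++ q) (p ++ v ++ q).
Proof.
move=> uv; apply: baxter_cong_cat; first exact: baxter_cong_refl.
by apply: baxter_cong_cat => //; apply: baxter_cong_refl.
Qed.

(** With [x < y], [x < c <= y] and [x <= b < y], the first generator applies
    when [b < c] and the second one when [c <= b]. *)
Lemma baxter_swap x y b c p q :
    c \in p -> separates <%O c x y -> b \in q -> separates <=%O b x y ->
  baxter_cong (p ++ x :: y :: q) (p ++ y :: x :: q).
Proof.
wlog ltxy : x y / x < y => [hwlog|].
  have [xy | yx | -> *] := ltgtP x y; first exact: hwlog.
    rewrite separatesC (separatesC _ b) => *.
    by apply/baxter_cong_sym/hwlog.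
  exact: baxter_cong_refl.
rewrite separates_ltP // separates_leP //.
move=> /splitPr[p1 p2] /andP[xc cy] /splitPr[q1 q2] /andP[xb b_y].
have -> : (p1 ++ c :: p2) ++ x :: y :: q1 ++ b :: q2 =
    p1 ++ (c :: p2 ++ x :: y :: q1 ++ [:: b]) ++ q2.
  by rewrite -!catA /= -!catA /= -catA.
have -> : (p1 ++ c :: p2) ++ y :: x :: q1 ++ b :: q2 =
    p1 ++ (c :: p2 ++ y :: x :: q1 ++ [:: b]) ++ q2.
  by rewrite -!catA /= -!catA /= -catA.
apply: baxter_cong_ctx; case: (ltP b c) => [bc | cb].
  by apply: baxter_cong_gen; apply: baxter_gen1.
by apply: baxter_cong_sym; apply: baxter_cong_gen; apply: baxter_gen2.
Qed.

(** Since [u] contains no [x], the [x] shown in both words has the same rank.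
    In the second word it precedes the occurrence of [y] shown in the first
    one, since only the letters [y] of [p] come before it.  Read from the
    left, [y x] is thus inverted in the second word, with prefix [rcons p x];
    read from the right, [x y] is inverted, with prefix [rev v]. *)
Lemma inversion_separators x y p u q v :
    Psymbol (p ++ u ++ y :: x :: q) = Psymbol (p ++ x :: v) ->
    x \notin u -> x != y ->
  (exists2 c, c \in p ++ u & separates <%O c y x) /\
  (exists2 b, b \in q & separates <=%O b y x).
Proof.
rewrite !PsymbolE => -[eqL eqR] xu xy.
have cnt z : count_mem z (p ++ u ++ y :: x :: q) = count_mem z (p ++ x :: v).
  exact/permP/(search_tree_perm eqL).
have x_y : (x == y) = false by apply/negbTE.
have y_x : (y == x) = false by rewrite eq_sym.
have := cnt x; have := cnt y; rewrite !count_cat /= !eqxx x_y y_x.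
rewrite (count_memPn xu) => /addnI cy /addnI cx.
split.
  apply: (@separator_of_inversion _ _ y x (p ++ u) q (rcons p x) v).
  - by rewrite cat_rcons -catA eqL.
  - by rewrite -cats1 !count_cat /= eqxx (count_memPn xu) !addn0 addn1.
  by rewrite -cats1 !count_cat /= x_y !addn0 leq_addr.
have [|||b bq sep] := @separator_of_inversion _ (<=%O : rel A) x y
    (rev q) (rev (p ++ u)) (rev v) (x :: rev p).
- have rev_mv : rev (p ++ u ++ y :: x :: q) = rev q ++ x :: y :: rev (p ++ u).
    by rewrite catA rev_cat !rev_cons !cat_rcons.
  by rewrite -rev_mv eqR rev_cat rev_cons cat_rcons.
- by rewrite !count_rev -[leqRHS]cy addnCA ltnS leq_addl.
- by move: cx; rewrite !count_rev !add0n => /addnI ->.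
by exists b; [rewrite -mem_rev | rewrite separatesC].
Qed.

Lemma baxter_move_to_front x p u q v :
    Psymbol (p ++ u ++ x :: q) = Psymbol (p ++ x :: v) -> x \notin u ->
  baxter_cong (p ++ u ++ x :: q) (p ++ x :: u ++ q).
Proof.
elim/last_ind: u q => [|u y IHu] q; first by move=> *; apply: baxter_cong_refl.
rewrite mem_rcons inE negb_or cat_rcons => eqP /andP[xy xu].
have [[c cpu sep_c] [b bq sep_b]] := inversion_separators eqP xu xy.
apply: (@baxter_cong_trans _ _ _ (p ++ u ++ x :: y :: q)).
  by rewrite !catA; apply: baxter_swap sep_c bq sep_b.
rewrite cat_rcons; apply: IHu => //.
by rewrite -eqP !catA; apply/esym/(Psymbol_swap cpu sep_c bq sep_b).
Qed.

Lemma mem_split_first x u :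
  x \in u -> exists u1 u2, u = u1 ++ x :: u2 /\ x \notin u1.
Proof.
rewrite -has_pred1 => /split_find[_ u1 u2 /eqP-> xu1]; exists u1, u2.
by rewrite cat_rcons -has_pred1.
Qed.

(** The common prefix [p] has to be kept: removing the first letter of a word
    forgets how the left tree was split, so that the remaining suffixes alone
    need not have the same P-symbol. *)
Lemma baxter_of_Psymbol p u v :
  Psymbol (p ++ u) = Psymbol (p ++ v) -> baxter_cong (p ++ u) (p ++ v).
Proof.
elim: v p u => [|x v IHv] p u eqP.
  have : perm_eq (p ++ u) (p ++ [::]).
    by move: eqP; rewrite !PsymbolE => -[/search_tree_perm].
  by rewrite perm_cat2l => /perm_nilP->; apply: baxter_cong_refl.
have /perm_mem/(_ x) : perm_eq u (x :: v).
  rewrite -(perm_cat2l p).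
  by move: eqP; rewrite !PsymbolE => -[/search_tree_perm].
rewrite mem_head => /mem_split_first[u1 [u2 [eq_u xu1]]].
rewrite {}eq_u in eqP *.
have mv := baxter_move_to_front eqP xu1; apply: (baxter_cong_trans mv).
rewrite -!(cat_rcons x p); apply: IHv; rewrite !cat_rcons -eqP.
by have := baxter_cong_Psymbol mv [::] [::]; rewrite /= !cats0 => ->.
Qed.

End Baxter.

Theorem proposition4p4 (d : Order.disp_t) (A : orderType d) (a : nat -> A)
    (a_incr : forall i j : nat, (i < j)%N -> (a i < a j)%O)
    (a_surj : forall x : A, exists i : nat, a i = x)
    (u v : seq A) :
  baxter_cong u v <-> Psymbol u = Psymbol v.
Proof.
split; last exact: (@baxter_of_Psymbol _ _ [::]).
by move/baxter_cong_Psymbol => /(_ [::] [::]); rewrite /= !cats0.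
Qed.
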